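(* Suppose $\mathcal{X}_1,\mathcal{X}_2,\ldots$ is a sequence of random variables corresponding to cyclotomic generating functions (each with positive variance) such that $\mathcal{X}_n^*\Rightarrow\mathcal{X}$ for some random variable $\mathcal{X}$. Then $\mathcal{X}$ is determined by its moments and, for all $d\in\mathbb{Z}_{\ge1}$, $\lim_{n\to\infty}\mu_d^{\mathcal{X}_n^*}=\mu_d^{\mathcal{X}}$.
   Context: A cyclotomic generating function is a nonzero polynomial $f(q)=\sum_kc_kq^k$ with nonnegative integer coefficients all of whose complex roots are roots of unity or $0$; its random variable $\mathcal{X}$ has $P(\mathcal{X}=k)=c_k/f(1)$. $\mathcal{X}^*=(\mathcal{X}-\mu)/\sigma$ is the standardization; $\mu_d^{\mathcal{Y}}=\mathbb{E}[\mathcal{Y}^d]$; $\Rightarrow$ is convergence in distribution. *)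

(* Defs.v *)
From HB Require Import structures.
From mathcomp Require Import all_boot all_order all_algebra.
From mathcomp Require Import complex.
From mathcomp Require Import all_classical all_reals all_analysis.
From mathcomp Require Import measurable_realfun.

Set Implicit Arguments.
Unset Strict Implicit.
Unset Printing Implicit Defensive.

Import Order.TTheory GRing.Theory Num.Theory.
Import numFieldNormedType.Exports.

Local Open Scope classical_set_scope.
Local Open Scope complex_scope.
Local Open Scope ring_scope.

(* [0.-unity_root z] holds for every [z], hence the side condition on [n]. *)
Definition is_cgf (R : realType) (f : {poly int}) : Prop :=
  [/\ f != 0,
      forall k : nat, 0 <= f`_k &
      forall z : R[i], root (map_poly intr f) z ->
        z = 0 \/ exists2 n : nat, (0 < n)%N & n.-unity_root z].

(* These values sum to 1, hence pin down the law of [X]. *)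
Definition has_cgf_law d (T : measurableType d) (R : realType)
    (P : probability T R) (X : {RV P >-> R}) (f : {poly int}) : Prop :=
  forall k : nat, P [set w | X w = k%:R] = ((f`_k)%:~R / (f.[1])%:~R)%:E.

Section standardize.
Context d (T : measurableType d) (R : realType) (P : probability T R).
Variable X : {RV P >-> R}.

Definition standardize : T -> R :=
  fun w => (X w - fine 'E_P[X]) / Num.sqrt (fine 'V_P[X]).

Let measurable_standardize : measurable_fun [set: T] standardize.
Proof.
apply: measurable_funM; last exact: measurable_cst.
by apply: measurable_funB; [exact: measurable_funPT | exact: measurable_cst].
Qed.

HB.instance Definition _ :=
  isMeasurableFun.Build _ _ _ _ standardize measurable_standardize.

Definition standardized : {RV P >-> R} := standardize.

End standardize.

Definition moment d (T : measurableType d) (R : realType)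
    (P : probability T R) (X : {RV P >-> R}) (k : nat) : \bar R :=
  'E_P[fun w => X w ^+ k].

Definition has_moments d (T : measurableType d) (R : realType)
    (P : probability T R) (X : {RV P >-> R}) : Prop :=
  forall k : nat, P.-integrable [set: T] (EFin \o (fun w => X w ^+ k)).

(* Laws are compared on measurable sets only: the value of a measure on a
   nonmeasurable set is unspecified. *)
Definition determined_by_moments d (T : measurableType d) (R : realType)
    (P : probability T R) (X : {RV P >-> R}) : Prop :=
  has_moments X /\
  forall d' (S : measurableType d') (Q : probability S R) (Y : {RV Q >-> R}),
    has_moments Y ->
    (forall k : nat, moment Y k = moment X k) ->
    forall A : set R, measurable A -> distribution Q Y A = distribution P X A.

(* The variables [Xs n] may live on different probability spaces. *)
Definition cvg_in_distribution (R : realType) (ds : nat -> measure_display)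
    (Ts : forall n, measurableType (ds n)) (Ps : forall n, probability (Ts n) R)
    (Xs : forall n, {RV (Ps n) >-> R})
    d (T : measurableType d) (P : probability T R) (X : {RV P >-> R}) : Prop :=
  forall x : R, {for x, continuous (cdf X)} ->
    cdf (Xs n) x @[n --> \oo] --> cdf X x.

(* Main.v *)
(* A root [z] on the unit circle contributes to a cyclotomic generating function
   [f] the factor [|q - z|^2 / |1 - z|^2 = q (1 + 2 v (cosh s - 1))] at
   [q = exp s], where [v = 1 / (2 (1 - Re z))] is its share of the variance. Hence
   the centered variable satisfies
   [E exp (s (X - mu)) <= exp (sigma^2 (cosh s - 1))]. As [sigma^2 >= 1/4], this
   bounds the moment generating functions of the standardized variables uniformly.
   All their moments are then uniformly bounded, so convergence in distribution
   entails convergence of moments, by dominated convergence in the formulas that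
   express means as integrals of distribution functions. The limit inherits the
   moment bounds, hence has all exponential moments, and so has any [Y] with the
   same moments. Then [X] and [Y] give the same mean to every polynomial in
   [w = (1 + sin (t (x - c))) / 2], in particular to [(1 - w^n)^(n 2^n)], which
   tends to the indicator of [w < 1/2]; letting [t] tend to [0] gives
   [P (X < c) = P (Y < c)]. *)

Require Import Defs.
From HB Require Import structures.
From mathcomp Require Import all_boot all_order all_algebra.
From mathcomp Require Import complex.
From mathcomp Require Import all_classical all_reals all_analysis.
From mathcomp Require Import measurable_realfun.
From mathcomp Require Import ring lra.

Set Implicit Arguments.
Unset Strict Implicit.
Unset Printing Implicit Defensive.

Import Order.TTheory GRing.Theory Num.Theory.
Import numFieldNormedType.Exports.

Local Open Scope classical_set_scope.
Local Open Scope ring_scope.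

(** * Polynomials with roots on the unit circle *)

Section log_derivatives.
Variable F : fieldType.
Implicit Types p q : {poly F}.

(** First and second derivatives of [log (p (exp s))] at [s = 0]. For a generating polynomial they
    are the mean and the variance; turning products into sums, they can be computed root by root. *)
Definition logder1 p : F := p^`().[1] / p.[1].
Definition logder2 p : F :=
  p^`()^`().[1] / p.[1] - logder1 p ^+ 2 + logder1 p.

Lemma logder1M p q : p.[1] != 0 -> q.[1] != 0 ->
  logder1 (p * q) = logder1 p + logder1 q.
Proof.
move=> p1 q1; rewrite /logder1 derivM !(hornerD, hornerM).
by field; rewrite ?p1 ?q1.
Qed.

Lemma logder2M p q : p.[1] != 0 -> q.[1] != 0 ->
  logder2 (p * q) = logder2 p + logder2 q.
Proof.
move=> p1 q1; rewrite /logder2 /logder1 !(derivM, derivD) !(hornerD, hornerM).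
by field; rewrite ?p1 ?q1.
Qed.

Lemma logder1Z c p : c != 0 -> logder1 (c *: p) = logder1 p.
Proof.
move=> c0; rewrite /logder1 derivZ !hornerE invfM mulrACA mulfV ?mul1r//.
Qed.

Lemma logder2Z c p : c != 0 -> logder2 (c *: p) = logder2 p.
Proof.
move=> c0; rewrite /logder2 logder1Z// !derivZ !hornerE invfM mulrACA.
by rewrite mulfV ?mul1r.
Qed.

Lemma horner_prod_XsubC (rs : seq F) x :
  (\prod_(z <- rs) ('X - z%:P)).[x] = \prod_(z <- rs) (x - z).
Proof. by rewrite horner_prod; apply: eq_bigr => z _; rewrite !hornerE. Qed.

Lemma logder1_prod_XsubC (rs : seq F) : 1 \notin rs ->
  logder1 (\prod_(z <- rs) ('X - z%:P)) = \sum_(z <- rs) (1 - z)^-1.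
Proof.
elim: rs => [|z rs IH]; first by rewrite !big_nil /logder1 derivC hornerC mul0r.
rewrite inE negb_or => /andP[z1 rs1]; rewrite !big_cons logder1M ?IH//.
- by rewrite /logder1 derivXsubC !hornerE ?mul1r.
- by rewrite !hornerE subr_eq0.
- rewrite horner_prod_XsubC prodf_seq_neq0; apply/allP => y yrs /=.
  by rewrite subr_eq0; apply: contraNneq rs1 => ->.
Qed.

Lemma logder2_prod_XsubC (rs : seq F) : 1 \notin rs ->
  logder2 (\prod_(z <- rs) ('X - z%:P)) = \sum_(z <- rs) - z / (1 - z) ^+ 2.
Proof.
elim: rs => [|z rs IH].
  by rewrite !big_nil /logder2 /logder1 !derivC !hornerC !mul0r expr0n/= subr0 addr0.
rewrite inE negb_or => /andP[z1 rs1]; rewrite !big_cons logder2M ?IH//.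
- rewrite /logder2 /logder1 derivXsubC derivC !hornerE.
  by congr (_ + _); field; rewrite subr_eq0.
- by rewrite !hornerE subr_eq0.
- rewrite horner_prod_XsubC prodf_seq_neq0; apply/allP => y yrs /=.
  by rewrite subr_eq0; apply: contraNneq rs1 => ->.
Qed.

End log_derivatives.

Lemma logder1_map (K L : fieldType) (phi : {rmorphism K -> L}) (p : {poly K}) :
  logder1 (map_poly phi p) = phi (logder1 p).
Proof. by rewrite /logder1 deriv_map -(rmorph1 phi) !horner_map fmorph_div. Qed.

Lemma logder2_map (K L : fieldType) (phi : {rmorphism K -> L}) (p : {poly K}) :
  logder2 (map_poly phi p) = phi (logder2 p).
Proof.
rewrite /logder2 logder1_map !deriv_map -[X in _.[X] / _.[X]](rmorph1 phi).
by rewrite !horner_map rmorphD rmorphB rmorphXn !fmorph_div.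
Qed.

(** * Shares of a single root in the mean and the variance *)

Section complex_roots.
Variable R : realType.
Implicit Types z w : R[i].

(** The squared modulus, valued in [R], whereas the norm of [R[i]] is valued in [R[i]]. *)
Definition sqnorm z : R := complex.Re z ^+ 2 + complex.Im z ^+ 2.

Lemma sqnormM z w : sqnorm (z * w) = sqnorm z * sqnorm w.
Proof. by case: z => a b; case: w => c d; rewrite /sqnorm /=; ring. Qed.

Lemma sqnorm1 : sqnorm 1 = 1.
Proof. by rewrite /sqnorm/= expr1n expr0n addr0. Qed.

Lemma sqnorm_prod (I : Type) (rs : seq I) (h : I -> R[i]) :
  sqnorm (\prod_(z <- rs) h z) = \prod_(z <- rs) sqnorm (h z).
Proof. exact: (big_morph _ sqnormM sqnorm1). Qed.

Lemma sqnorm_real (x : R) : sqnorm x%:C%C = x ^+ 2.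
Proof. by rewrite /sqnorm /= expr0n addr0. Qed.

Lemma sqnorm_unity_root n z : (0 < n)%N -> n.-unity_root z -> sqnorm z = 1.
Proof.
move=> n0 /unity_rootP zn.
have : sqnorm z ^+ n = 1.
  by rewrite -sqnorm1 -zn; elim: (n) => [|m IH]; rewrite ?sqnorm1// !exprS sqnormM IH.
by move/eqP; rewrite pexprn_eq1 ?addr_ge0 ?sqr_ge0// eqn0Ngt n0 => /eqP.
Qed.

(** Shares of the root [z] in the mean and in the variance. The root [0] stands for a factor [q], a
    shift by one, which adds nothing to the variance. *)
Definition root_mean z : R := if z == 0 then 1 else 2^-1.
Definition root_var z : R :=
  if z == 0 then 0 else (2 * (1 - complex.Re z))^-1.

Definition unit_or_0 z := z = 0 \/ sqnorm z = 1.

Lemma Re_lt1 z : sqnorm z = 1 -> z != 1 -> complex.Re z < 1.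
Proof.
case: z => a b; rewrite /sqnorm /= => ab1 /eqP z1.
rewrite ltNge; apply/negP => a1; apply: z1.
have a2 : a = 1 by have := sqr_ge0 b; nra.
have b2 : b ^+ 2 = 0 by rewrite a2 in ab1; lra.
by move/eqP: b2; rewrite sqrf_eq0 => /eqP ->; rewrite a2.
Qed.

Lemma sqnorm_neq0 z : sqnorm z = 1 -> z != 0.
Proof.
by apply: contra_eqN => /eqP->; rewrite /sqnorm/= expr0n addr0 eq_sym oner_eq0.
Qed.

(** The map [z -> 1 / (1 - z)] sends the unit circle without [1] to the line of real part [1/2]. *)
Lemma Re_inv1B z : unit_or_0 z -> z != 1 -> complex.Re (1 - z)^-1 = root_mean z.
Proof.
rewrite /root_mean => -[->|zu z1]; first by rewrite eqxx subr0 invr1.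
have za := Re_lt1 zu z1; rewrite (negbTE (sqnorm_neq0 zu)).
case: z zu {z1} za => a b; rewrite /sqnorm /= => ab a1.
have -> : (1 - a) ^+ 2 + (0 - b) ^+ 2 = 2 * (1 - a) by nra.
by field; lra.
Qed.

(** On the unit circle the conjugate of [1 - z] is [- (1 - z) / z], so that
    [(1 - z)^2 = - z |1 - z|^2], with [|1 - z|^2 = 2 (1 - Re z)]. *)
Lemma root_varE z : unit_or_0 z -> z != 1 ->
  - z / (1 - z) ^+ 2 = (root_var z)%:C%C.
Proof.
rewrite /root_var => -[->|zu z1]; first by rewrite eqxx oppr0 mul0r.
have za := Re_lt1 zu z1; rewrite (negbTE (sqnorm_neq0 zu)).
have z1' : (1 - z) ^+ 2 != 0 by rewrite sqrf_eq0 subr_eq0 eq_sym.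
apply: (mulIf z1'); rewrite mulfVK//.
case: z zu {z1 z1'} za => a b; rewrite /sqnorm /= => ab a1.
rewrite expr2; congr (_ +i* _)%C => /=.
  have -> : (1 - a) * (1 - a) - (0 - b) * (0 - b) = 2 * (1 - a) * (- a) by nra.
  by field; lra.
by field; lra.
Qed.

(** On the unit circle [2 (1 - Re z) <= 4]. This gap keeps positive variances away from zero. *)
Lemma root_var_ge z : unit_or_0 z -> z != 1 ->
  root_var z = 0 \/ 4^-1 <= root_var z.
Proof.
rewrite /root_var => -[->|zu z1]; first by rewrite eqxx; left.
have za := Re_lt1 zu z1; rewrite (negbTE (sqnorm_neq0 zu)); right.
rewrite lef_pV2 ?posrE//; last lra.
case: z zu {z1} za => a b; rewrite /sqnorm/=; have := sqr_ge0 b; nra.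
Qed.

(* The factor [(expR s + expR (- s)) / 2 - 1] is [cosh s - 1]. *)
Lemma sqnorm_expRB s z : unit_or_0 z -> z != 1 ->
  sqnorm ((expR s)%:C%C - z) <= sqnorm (1 - z) *
    expR (2 * (s * root_mean z + ((expR s + expR (- s)) / 2 - 1) * root_var z)).
Proof.
rewrite /root_mean /root_var => -[->|zu z1].
  rewrite eqxx !subr0 sqnorm1 mul1r sqnorm_real mulr1 mulr0 addr0.
  by rewrite expRM_natl.
have za := Re_lt1 zu z1; rewrite (negbTE (sqnorm_neq0 zu)).
case: z zu {z1} za => a b; rewrite /sqnorm /= => ab a1.
have q0 := expR_gt0 s; rewrite expRN; set q := expR s in q0 *.
rewrite (_ : (1 - a) ^+ 2 + (0 - b) ^+ 2 = 2 * (1 - a)); last by nra.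
rewrite [X in expR X]mulrDr (_ : 2 * (s / 2) = s); last by field.
rewrite expRD -/q; set t := (X in q * expR X).
(* Up to here there is equality, by [a^2 + b^2 = 1]; the only loss is [1 + t <= exp t]. *)
apply: (@le_trans _ _ (2 * (1 - a) * (q * (1 + t)))).
  rewrite [leRHS](_ : _ = q ^+ 2 - 2 * a * q + 1); last first.
    by rewrite /t; field; rewrite gt_eqF//; lra.
  nra.
by apply: ler_wpM2l; [lra|apply: ler_wpM2l; [exact: ltW|exact: expR_ge1Dx]].
Qed.

End complex_roots.

(** * Generating polynomials factored over the complex numbers *)

Section cgf_polynomial.
Variables (R : realType) (f : {poly int}).
Hypothesis fcgf : is_cgf R f.

Let F : {poly R} := map_poly intr f.

Lemma cgf_horner1 : f.[1] = \sum_(k < size f) f`_k.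
Proof. by rewrite horner_coef; apply: eq_bigr => i _; rewrite expr1n mulr1. Qed.

Lemma cgf_horner1_gt0 : 0 < f.[1].
Proof.
case: fcgf => f0 fge0 _; rewrite cgf_horner1 lt_def sumr_ge0// andbT.
have sf : (0 < size f)%N by rewrite size_poly_gt0.
have /ltn_predK psf := sf.
rewrite psumr_neq0//; apply/hasP; exists (cast_ord psf ord_max).
  by rewrite mem_index_enum.
by rewrite /= lt_def fge0 andbT -lead_coefE lead_coef_eq0.
Qed.

Let F1 : F.[1] = f.[1]%:~R.
Proof. by rewrite -(rmorph1 intr) horner_map. Qed.

Let F1_gt0 : 0 < F.[1].
Proof. by rewrite F1 ltr0z cgf_horner1_gt0. Qed.

Lemma cgf_roots : exists2 rs : seq R[i],
  map_poly (real_complex R) F =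
    (lead_coef F)%:C%C *: \prod_(z <- rs) ('X - z%:P) &
  forall z, z \in rs -> unit_or_0 z /\ z != 1.
Proof.
have [rs rsE] := closed_field_poly_normal (map_poly (real_complex R) F).
have lF : lead_coef (map_poly (real_complex R) F) = (lead_coef F)%:C%C.
  by rewrite lead_coef_map.
have F0 : F != 0 by apply: contra_ltN F1_gt0 => /eqP ->; rewrite horner0.
have lF0 : lead_coef (map_poly (real_complex R) F) != 0.
  by rewrite lead_coef_eq0 map_poly_eq0.
exists rs; first by rewrite [LHS]rsE lF.
move=> z zrs; have rz : root (map_poly (real_complex R) F) z.
  by rewrite rsE rootZ// root_prod_XsubC.
split.
  case: fcgf => _ _ /(_ z) [|->|[n n0 zn]]; [|by left|].
    suff -> : map_poly intr f = map_poly (real_complex R) F by [].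
    rewrite /F -map_poly_comp; apply: eq_map_poly => x /=.
    by rewrite rmorph_int.
  by right; exact: sqnorm_unity_root zn.
apply: contraTneq rz => ->; rewrite /root -(rmorph1 (real_complex R)).
by rewrite horner_map fmorph_eq0 gt_eqF.
Qed.

(** The values of [F] are squared so that their factorization takes place in [R], through squared
    moduli. The mean is real, hence the sum of the real parts of its complex terms; for the variance
    each term is already real. *)
Lemma cgf_logders_roots : exists rs : seq R[i],
  [/\ forall z, z \in rs -> unit_or_0 z /\ z != 1,
      forall q : R, F.[q] ^+ 2 =
        lead_coef F ^+ 2 * \prod_(z <- rs) sqnorm (q%:C%C - z),
      logder1 F = \sum_(z <- rs) root_mean z &
      logder2 F = \sum_(z <- rs) root_var z].
Proof.
have [rs FE rs1] := cgf_roots; exists rs.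
have rs1' : 1 \notin rs by apply/negP => /rs1[_]; rewrite eqxx.
have l0 : (lead_coef F)%:C%C != 0.
  rewrite fmorph_eq0 lead_coef_eq0.
  by apply: contra_ltN F1_gt0 => /eqP ->; rewrite horner0.
split => // [q||].
- rewrite -sqnorm_real -(horner_map (real_complex R)) FE hornerZ sqnormM.
  by rewrite sqnorm_real horner_prod_XsubC sqnorm_prod.
- have /(congr1 (@complex.Re R)) := logder1_map (real_complex R) F.
  rewrite FE logder1Z// logder1_prod_XsubC//= => <-.
  rewrite raddf_sum; rewrite big_seq [RHS]big_seq; apply: eq_bigr => z zrs.
  by have [? ?] := rs1 z zrs; rewrite -Re_inv1B.
- apply: (@complexI R); rewrite -(logder2_map (real_complex R) F).
  rewrite FE logder2Z// logder2_prod_XsubC//= rmorph_sum.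
  rewrite big_seq [RHS]big_seq; apply: eq_bigr => z zrs.
  by have [? ?] := rs1 z zrs; exact: root_varE.
Qed.

(** The product over all roots of the bounds [sqnorm_expRB], followed by a square root. Divided by
    [F.[1]], the left side is the moment generating function at [s]. *)
Lemma cgf_expR_le s : F.[expR s] <= F.[1] *
    expR (s * logder1 F + ((expR s + expR (- s)) / 2 - 1) * logder2 F).
Proof.
have [rs [rs1 sqF L1 L2]] := cgf_logders_roots; set ch := _ - 1.
rewrite -(@ler_pXn2r _ 2%N)// ?nnegrE; last 2 first.
- rewrite /F horner_coef sumr_ge0// => i _; rewrite mulr_ge0 ?exprn_ge0 ?expR_ge0//.
  by rewrite coef_map /= ler0z; case: fcgf.
- by rewrite mulr_ge0 ?expR_ge0 ?ltW.
rewrite exprMn !sqF -[leRHS]mulrA; apply: ler_wpM2l; first exact: sqr_ge0.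
rewrite -expRM_natl L1 L2 !mulr_sumr -[X in 2 * X]big_split mulr_sumr expR_sum.
rewrite -[leRHS]big_split /=.
rewrite big_seq [leRHS]big_seq; apply: ler_prod => z zrs.
have [zu z1] := rs1 z zrs.
by rewrite sqnorm_expRB// addr_ge0 ?sqr_ge0.
Qed.

(** A sum of terms each of which is zero or at least [1/4]. *)
Lemma cgf_logder2 : logder2 F = 0 \/ 4^-1 <= logder2 F.
Proof.
have [rs [rs1 _ _ ->]] := cgf_logders_roots.
elim: rs rs1 => [|z rs IH] rs1; first by left; rewrite big_nil.
have [zu z1] := rs1 z (mem_head _ _).
have {}IH := IH (fun y yrs => rs1 y (mem_behead (s := z :: rs) yrs)).
rewrite big_cons; case: IH (root_var_ge zu z1) => [->|h] [->|h'].
- by left; rewrite addr0.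
- by right; rewrite addr0.
- by right; rewrite add0r.
- by right; lra.
Qed.

End cgf_polynomial.

(** * Laws of cyclotomic generating functions *)

Section cgf_law.
Context d (T : measurableType d) (R : realType) (P : probability T R).
Variables (X : {RV P >-> R}) (f : {poly int}).
Hypotheses (fcgf : is_cgf R f) (lawX : has_cgf_law X f).

Let F : {poly R} := map_poly intr f.
Let p k : R := F`_k / F.[1].

Let F1E : F.[1] = f.[1]%:~R.
Proof. by rewrite -(rmorph1 intr) horner_map. Qed.

Let F1_gt0 : 0 < F.[1].
Proof. by rewrite F1E ltr0z (cgf_horner1_gt0 fcgf). Qed.

Let pE k : P (X @^-1` [set k%:R]) = (p k)%:E.
Proof. by rewrite [LHS]lawX /p coef_map/= F1E. Qed.

Let sump : \sum_(k < size F) p k = 1.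
Proof.
rewrite -mulr_suml (_ : \sum_(k < _) _ = F.[1]) ?divff ?gt_eqF//.
by rewrite horner_coef; apply: eq_bigr => i _; rewrite expr1n mulr1.
Qed.

(** The point masses at [k < size F] sum to one, so [g \o X] is almost surely the finite sum of the
    [g k] times the indicators of [X = k]. *)
Lemma cgf_expectation (g : R -> R) : measurable_fun [set: R] g ->
  'E_P[g \o X]%E = (\sum_(k < size F) p k * g k%:R)%:E.
Proof.
move=> mg; pose A (k : nat) := X @^-1` [set k%:R].
have mA k : measurable (A k) by exact: measurable_funPTI.
have tA : trivIset [set: nat] A.
  move=> i j _ _ [w [/= wi wj]]; apply/eqP.
  by rewrite -(eqr_nat R) -wi -wj.
pose h k w := ((g k%:R)%:E * (\1_(A k) w)%:E)%E.
have mh k : P.-integrable [set: T] (h k).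
  by apply: integrableZl => //; exact: integrable_indic.
pose B := \big[setU/set0]_(k < size F) A k.
have mB : measurable B by exact: bigsetU_measurable.
have PB : P B = 1%E.
  rewrite /B measure_bigsetU//.
  rewrite (eq_bigr (fun k : 'I_(size F) => (p k)%:E)) ?sumEFin ?sump// => k _.
  exact: pE.
have EgX : ae_eq P [set: T] (EFin \o (g \o X)) (fun w => \sum_(k < size F) h k w).
  exists (~` B); split; first exact: measurableC.
    by apply: etrans (probability_setC P mB) _; rewrite PB subee.
  move=> w; apply: contra_not => + _; rewrite /B -bigcup_mkord => -[k /= kF Akw].
  rewrite (bigD1 (Ordinal kF))//= big1 ?addr0 => [|i ik].
    by rewrite /h indicE mem_set// mule1 Akw.
  rewrite /h indicE memNset ?mule0// => Aiw.
  case/negP: ik; apply/eqP/val_inj => /=.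
  by apply: (tA) => //; exists w.
rewrite unlock (ae_eq_integral (fun w => \sum_(k < size F) h k w))//; last 2 first.
- by apply/measurable_EFinP; exact: measurableT_comp.
- by apply: emeasurable_sum => k; exact: measurable_int (mh k).
rewrite integral_sum// -sumEFin; apply: eq_bigr => k _.
rewrite integralZl//; last exact: integrable_indic.
rewrite (_ : \int[P]_x _ = (p k)%:E)%E; first by rewrite -EFinM mulrC.
by rewrite integral_indic// setIT; exact: pE.
Qed.

Let sumX : F^`().[1] = \sum_(k < size F) F`_k * k%:R.
Proof.
rewrite -{1}(coefK F) poly_def raddf_sum horner_sum; apply: eq_bigr => k _ /=.
by rewrite derivZ derivXn hornerZ hornerMn hornerXn expr1n.
Qed.

Let sumXX : F^`()^`().[1] = \sum_(k < size F) F`_k * (k%:R * (k%:R - 1)).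
Proof.
rewrite -{1}(coefK F) poly_def !raddf_sum horner_sum; apply: eq_bigr => k _ /=.
rewrite derivZ derivXn derivZ derivMn derivXn hornerZ !hornerMn hornerXn expr1n.
(* At [k = 0] the truncated predecessor is not [k - 1], but the factor [k] vanishes. *)
case: (k : nat) => [|m] /=; first by rewrite mulr0n mul0r.
by rewrite -[X in _ * (X - 1)]natr1 addrK -mulr_natr; congr (_ * _); rewrite mulrC.
Qed.

Lemma cgf_mean : 'E_P[X]%E = (logder1 F)%:E.
Proof.
have -> : 'E_P[X]%E = 'E_P[idfun \o X]%E by [].
rewrite cgf_expectation; last exact: measurable_id.
congr (_%:E).
rewrite /logder1 sumX mulr_suml; apply: eq_bigr => k _.
by rewrite /p mulrAC.
Qed.

Lemma cgf_variance : 'V_P[X]%E = (logder2 F)%:E.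
Proof.
set m := logder1 F.
have -> : 'V_P[X]%E = 'E_P[(fun x => (x - m) * (x - m))%R \o X]%E.
  rewrite /variance unlock cgf_mean /=; congr expectation.
rewrite cgf_expectation; last first.
  by apply: measurable_funM; apply: measurable_funB.
congr (_%:E); rewrite /logder2 -/m.
(* The left side is the factorial moment [E [X (X - 1)]]. *)
have -> : F^`()^`().[1] / F.[1] = \sum_(k < size F) p k * k%:R ^+ 2 - m.
  rewrite /m /logder1 sumX sumXX !mulr_suml -sumrB.
  by apply: eq_bigr => k _; rewrite /p; ring.
rewrite (eq_bigr (fun k : 'I_(size F) =>
  p k * k%:R ^+ 2 - (2 * m) * (p k * k%:R) + m ^+ 2 * p k)); last first.
  by move=> k _; ring.
rewrite big_split sumrB/= -!mulr_sumr sump.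
have -> : \sum_(k < size F) p k * k%:R = m.
  by rewrite /m /logder1 sumX mulr_suml; apply: eq_bigr => k _; rewrite /p mulrAC.
ring.
Qed.

(** Here [E exp (t X) = F (exp t) / F (1)], and centering cancels the linear term in the exponent of
    [cgf_expR_le]. *)
Lemma cgf_centered_mgf_le (t : R) : ('E_P[fun w => expR (t * (X w - logder1 F))]
  <= (expR (((expR t + expR (- t)) / 2 - 1) * logder2 F))%:E)%E.
Proof.
rewrite (@cgf_expectation (fun x => expR (t * (x - logder1 F)))); last first.
  apply: measurableT_comp => //; apply: measurable_funM => //.
  exact: measurable_funB.
rewrite lee_fin.
have -> : \sum_(k < size F) p k * expR (t * (k%:R - logder1 F)) =
    expR (- (t * logder1 F)) * (F.[expR t] / F.[1]).
  rewrite horner_coef mulr_suml mulr_sumr; apply: eq_bigr => k _.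
  by rewrite /p mulrBr expRD mulrC (mulrC t) expRM_natl; ring.
rewrite expRN ler_pdivrMl ?expR_gt0// ler_pdivrMr// -expRD mulrC.
exact: cgf_expR_le.
Qed.

End cgf_law.

(** * Inequalities for the exponential and the hyperbolic cosine *)

Section exponential_inequalities.
Variable R : realType.
Implicit Types x t : R.

(** For even [n] the left side is a single term of the series of [exp |x|], and [exp |x|] is one of
    the two summands on the right. *)
Lemma even_expn_le_expR x n : ~~ odd n -> x ^+ n / n`!%:R <= expR x + expR (- x).
Proof.
move=> en; rewrite -(ger0_norm (exprn_even_ge0 x en)) normrX.
have expR_norm : expR `|x| <= expR x + expR (- x).
  by case: (ger0P x) => _; rewrite ?lerDl ?lerDr expR_ge0.
apply: le_trans expR_norm; case: n {en} => [|n].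
  by rewrite expr0 fact0 divr1 (le_trans _ (expR_ge1Dx _))// lerDl.
by apply: le_trans (expR_ge1Dxn n (normr_ge0 x)); rewrite lerDr.
Qed.

(** One has [cosh t - 1 = (exp t - 1)^2 / (2 exp t)], and [exp t - 1 <= t exp t] follows from
    [1 - t <= exp (- t)]. *)
Lemma coshB1_le t : 0 <= t ->
  (expR t + expR (- t)) / 2 - 1 <= t ^+ 2 / 2 * expR t.
Proof.
move=> t0; have e : expR t = expR (t / 2) ^+ 2.
  by rewrite -expRM_natl; congr expR; field.
have h0 := expR_gt0 (t / 2); set h := expR (t / 2) in e h0.
have h1 : 1 - t <= (h ^+ 2)^-1 by rewrite -e -expRN expR_ge1Dx.
have h2 : h ^+ 2 - 1 <= t * h ^+ 2.
  have := ler_wpM2r (ltW (exprn_gt0 2 h0)) h1.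
  by rewrite mulVf ?gt_eqF ?exprn_gt0//; lra.
have h3 : 1 <= h ^+ 2 by rewrite -e; have := expR_ge1Dx t; lra.
rewrite expRN e.
have -> : (h ^+ 2 + (h ^+ 2)^-1) / 2 - 1 = (h ^+ 2 - 1) ^+ 2 / (2 * h ^+ 2).
  by field; rewrite gt_eqF.
rewrite ler_pdivrMr; last by rewrite mulr_gt0// exprn_gt0.
have -> : t ^+ 2 / 2 * h ^+ 2 * (2 * h ^+ 2) = (t * h ^+ 2) ^+ 2 by field.
by rewrite ler_pXn2r// nnegrE; nra.
Qed.

End exponential_inequalities.

(** * Uniform bounds for standardized variables *)

Section standardized_cgf.
Context d (T : measurableType d) (R : realType) (P : probability T R).
Variables (X : {RV P >-> R}) (f : {poly int}).
Hypotheses (fcgf : is_cgf R f) (lawX : has_cgf_law X f).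
Hypothesis V_gt0 : (0 < 'V_P[X])%E.

Let F : {poly R} := map_poly intr f.
Let m := logder1 F.
Let v := logder2 F.

Let v_ge : 4^-1 <= v.
Proof.
move: V_gt0; rewrite (cgf_variance fcgf lawX) lte_fin => v0.
by case: (cgf_logder2 fcgf) => // v0'; rewrite v0' ltxx in v0.
Qed.

Lemma standardized_cgfE w : standardized X w = (X w - m) / Num.sqrt v.
Proof.
by rewrite /standardized/= /standardize (cgf_variance fcgf lawX) (cgf_mean fcgf lawX).
Qed.

(** With [s] the standard deviation, the exponent [s^2 (cosh (a / s) - 1)] is at most
    [a^2 / 2 * exp (a / s)], and [s >= 1/2] gives [a / s <= 2 a]. The bound is independent of
    [f]. *)
Lemma standardized_mgf_le (a b : R) : 0 <= a -> b = a \/ b = - a ->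
  ('E_P[fun w => expR (b * standardized X w)] <=
    (expR (a ^+ 2 / 2 * expR (2 * a)))%:E)%E.
Proof.
move=> a0 ba; set s := Num.sqrt v.
have s0 : 2^-1 <= s.
  rewrite -(@ler_pXn2r _ 2)// ?nnegrE ?sqrtr_ge0// sqr_sqrtr; last by have := v_ge; lra.
  by rewrite exprVn -natrX.
have s2 : s ^+ 2 = v by rewrite sqr_sqrtr//; have := v_ge; lra.
under eq_fun do rewrite standardized_cgfE -/s mulrCA mulrC.
apply: le_trans (cgf_centered_mgf_le fcgf lawX (b / s)) _ => //.
rewrite lee_fin ler_expR -/F -/v.
have -> : expR (b / s) + expR (- (b / s)) = expR (a / s) + expR (- (a / s)).
  by case: ba => -> //; rewrite mulNr opprK addrC.
have as0 : 0 <= a / s by rewrite divr_ge0// sqrtr_ge0.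
apply: (@le_trans _ _ ((a / s) ^+ 2 / 2 * expR (a / s) * v)).
  by rewrite ler_wpM2r ?coshB1_le//; have := v_ge; lra.
rewrite -s2 [leLHS](_ : _ = a ^+ 2 / 2 * expR (a / s)); last by field; lra.
rewrite ler_wpM2l ?divr_ge0 ?sqr_ge0// ler_expR ler_pdivrMr; last lra.
by nra.
Qed.

(** The mean of [even_expn_le_expR] at [a W], with [W] the standardized variable. Leaving [a] free
    yields growth slower than [n! / a^n] for every [a], as determinacy will require. *)
Lemma standardized_even_moment_le (a : R) n : 0 < a -> ~~ odd n ->
  (moment (standardized X) n <=
    (2 * expR (a ^+ 2 / 2 * expR (2 * a)) * n`!%:R / a ^+ n)%:E)%E.
Proof.
move=> a0 en; rewrite /moment; set W := standardized X; set C := expR (_ / 2 * _).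
have mW : measurable_fun [set: T] W by exact: measurable_funPT.
have mE b : measurable_fun [set: T] (fun w => expR (b * W w)).
  by apply: measurableT_comp => //; exact: measurable_funM.
set c := n`!%:R / a ^+ n.
have c0 : 0 <= c by rewrite divr_ge0// exprn_ge0// ltW.
apply: (@le_trans _ _ 'E_P[(fun w => c * (expR (a * W w) + expR (- a * W w)))%R]%E).
  apply: expectation_le.
  - exact: measurable_funX.
  - by apply: measurable_funM => //; exact: measurable_funD.
  - by move=> w; rewrite exprn_even_ge0.
  - by move=> w; rewrite mulr_ge0// addr_ge0 ?expR_ge0.
  apply: aeW => w; rewrite mulNr.
  have := even_expn_le_expR (a * W w) en.
  rewrite exprMn -(ler_pM2l (x := c)) => [|]; last first.
    by rewrite divr_gt0 ?exprn_gt0// ltr0n fact_gt0.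
  rewrite [X in X <= _](_ : _ = W w ^+ n)//.
  by rewrite /c; field; rewrite expf_neq0 ?gt_eqF// ltr0n fact_gt0.
rewrite unlock.
under eq_integral do rewrite EFinM EFinD.
rewrite ge0_integralZl//; last 2 first.
- by apply: emeasurable_funD; exact/measurable_EFinP.
- by move=> w _; rewrite adde_ge0// lee_fin expR_ge0.
rewrite ge0_integralD//; last 2 first.
- exact/measurable_EFinP.
- exact/measurable_EFinP.
have -> : 2 * C * n`!%:R / a ^+ n = c * (C + C) by rewrite /c; ring.
rewrite [in leRHS]EFinM [in leRHS]EFinD lee_wpmul2l ?lee_fin// leeD//.
- by have := @standardized_mgf_le a a (ltW a0); rewrite unlock; apply; left.
- by have := @standardized_mgf_le a (- a) (ltW a0); rewrite unlock; apply; right.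
Qed.

End standardized_cgf.

(** * Convergence of moments *)

Section cdf_continuity.
Context d (T : measurableType d) (R : realType) (P : probability T R).
Variable Z : {RV P >-> R}.

(** Only left continuity is at stake. If [u n] tends to [r] from below, the indicators of [Z <= u n]
    converge to that of [Z <= r] outside the null event [Z = r]. *)
Lemma pmf0_cdf_continuous r : pmf Z r = 0 -> {for r, continuous (cdf Z)}.
Proof.
move=> Zr0; apply/left_right_continuousP; split; last exact: cdf_right_continuous.
have cE s : cdf Z s = (\int[P]_w (\1_(Z @^-1` `]-oo, s]) w)%:E)%E.
  by rewrite integral_indic// ?setIT//; exact: measurable_funPTI.
have PZr : P (Z @^-1` [set r]) = 0%E.
  by rewrite -[LHS]fineK ?fin_num_measure//; congr EFin.
rewrite -[X in _ --> X]fineK ?fin_num_measure//.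
apply/cvge_at_leftP => u [ur cvgu]; rewrite fineK ?fin_num_measure//.
under eq_fun do rewrite -/(cdf Z _) cE.
rewrite cE.
have m1 s : measurable_fun [set: T] (fun w => (\1_(Z @^-1` `]-oo, s]) w)%:E : \bar R).
  by apply/measurable_EFinP/measurable_indic; exact: measurable_funPTI.
have [//|//||||_ _ //] := (@dominated_convergence _ _ _ P setT measurableT
  (fun n w => (\1_(Z @^-1` `]-oo, u n]) w)%:E)
  (fun w => (\1_(Z @^-1` `]-oo, r]) w)%:E) (cst 1%E)).
- exists (Z @^-1` [set r]); split => //.
  move=> w /=; apply: contra_notP => /eqP Zwr _.
  have [Zltr|Zger] := ltP (Z w) r.
    apply: cvg_near_cst; have /cvgrPdist_lt/(_ (r - Z w)) := cvgu.
    rewrite subr_gt0 => /(_ Zltr); apply: filterS => n.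
    rewrite gtr0_norm ?subr_gt0// => un.
    by rewrite !indicE !mem_set//= in_itv/=; lra.
  apply: cvg_near_cst; apply: nearW => n.
  have Zgtr : r < Z w by rewrite lt_neqAle eq_sym Zwr.
  have ? := ur n.
  by rewrite !indicE !memNset//= in_itv/=; apply/negP; rewrite -ltNge; lra.
- exact: finite_measure_integrable_cst.
- apply: aeW => w n _; rewrite gee0_abs ?lee_fin// indicE; case: (_ \in _).
Qed.

(** Discontinuities occur only at atoms, which are countably many. Convergence in distribution is
    therefore convergence of distribution functions almost everywhere. *)
Lemma cdf_discontinuity_null :
  (@lebesgue_measure R).-negligible [set r | ~ {for r, continuous (cdf Z)}].
Proof.
exists [set r | 0 < pmf Z r]; split.
- exact/countable_measurable/pmf_gt0_countable.
- exact/countable_lebesgue_measure0/pmf_gt0_countable.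
- move=> r; apply: contra_notP => /negP; rewrite -leNgt => Zr.
  by apply: pmf0_cdf_continuous; apply/eqP; rewrite eq_le Zr pmf_ge0.
Qed.

End cdf_continuity.

(** * An integrable majorant for tails *)

Section tails.
Variable R : realType.
Let mu := @lebesgue_measure R.

Let inv_oneDsqr (K r : R) : \bar R := (K * (1 + r ^+ 2)^-1)%:E.

Let minv K : measurable_fun [set: R] (inv_oneDsqr K).
Proof.
apply/measurable_EFinP; apply: measurable_funM => //.
by apply: continuous_measurable_fun; exact: continuous_oneDsqrV.
Qed.

Let inv_ge0 K r : 0 <= K -> (0 <= inv_oneDsqr K r)%E.
Proof.
by move=> K0; rewrite lee_fin mulr_ge0// invr_ge0 addr_ge0// sqr_ge0.
Qed.

Lemma integrable_inv_oneDsqr_pos K : 0 <= K ->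
  mu.-integrable `[0, +oo[ (fun r => (K * (1 + r ^+ 2)^-1)%:E).
Proof.
move=> K0; apply/integrableP; split; first by apply: measurable_funTS; exact: minv.
under eq_integral do rewrite gee0_abs ?inv_ge0// EFinM.
rewrite ge0_integralZl//.
- by rewrite integral0y_oneDsqr ltry.
- apply/measurable_EFinP; apply: measurable_funTS.
  by apply: continuous_measurable_fun; exact: continuous_oneDsqrV.
- by move=> r _; rewrite lee_fin invr_ge0 addr_ge0// sqr_ge0.
Qed.

Lemma integrable_inv_oneDsqr_neg K : 0 <= K ->
  mu.-integrable `]-oo, 0[ (fun r => (K * (1 + r ^+ 2)^-1)%:E).
Proof.
move=> K0; apply/integrableP; split; first by apply: measurable_funTS; exact: minv.
have /integrableP[_] := integrable_inv_oneDsqr_pos K0; apply: le_lt_trans.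
rewrite ge0_integration_by_substitution0//; last first.
  by apply: measurableT_comp => //; exact: minv.
under [leRHS]eq_integral do rewrite sqrrN.
apply: ge0_subset_integral => //.
- by apply: measurable_funTS; apply: measurableT_comp => //; exact: minv.
- by apply: subset_itvl; rewrite bnd_simp.
Qed.

End tails.

(** * Tail bounds from the second moment *)

Section tail_bound.
Context d (T : measurableType d) (R : realType) (P : probability T R).
Variables (Z : {RV P >-> R}) (C : R).
Hypothesis ZC : (moment Z 2 <= C%:E)%E.

(** Markov's inequality for [1 + Z^2]; the added [1] makes the bound integrable near [r = 0] as
    well. *)
Lemma second_moment_tail (A : set T) r : measurable A ->
  (forall w, A w -> r ^+ 2 <= Z w ^+ 2) ->
  (P A <= ((1 + C) * (1 + r ^+ 2)^-1)%:E)%E.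
Proof.
move=> mA Ar; have r0 : 0 < 1 + r ^+ 2 by rewrite ltr_pwDl// sqr_ge0.
rewrite EFinM lee_pdivlMr// muleC.
have -> : ((1 + r ^+ 2)%:E * P A)%E = 'E_P[(fun w => (1 + r ^+ 2) * \1_A w)%R]%E.
  rewrite unlock; under [RHS]eq_integral do rewrite EFinM.
  by rewrite integralZl ?integral_indic ?setIT//; exact: integrable_indic.
apply: (@le_trans _ _ 'E_P[(fun w => 1 + Z w ^+ 2)%R]%E).
  have mZ2 : measurable_fun [set: T] (fun w => Z w ^+ 2).
    exact/measurable_funX/measurable_funPT.
  apply: expectation_le.
  - by apply: measurable_funM => //; exact: measurable_indic.
  - exact: measurable_funD.
  - by move=> w; rewrite mulr_ge0// ltW.
  - by move=> w; rewrite addr_ge0// sqr_ge0.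
  apply: aeW => w; have [wA|wA] := pselect (A w).
    by rewrite indicE mem_set// mulr1 lerD2l Ar.
  by rewrite indicE memNset// mulr0 addr_ge0// sqr_ge0.
move: ZC; rewrite /moment unlock => ZC'.
under eq_integral do rewrite EFinD.
rewrite ge0_integralD//.
- by rewrite integral_cst//= probability_setT mule1 EFinD leeD2l.
- by move=> w _; rewrite lee_fin sqr_ge0.
- exact/measurable_EFinP/measurable_funX/measurable_funPT.
Qed.

Lemma ccdf_le r : 0 <= r -> (ccdf Z r <= ((1 + C) * (1 + r ^+ 2)^-1)%:E)%E.
Proof.
move=> r0; apply: second_moment_tail; first exact: measurable_funPTI.
by move=> w /=; rewrite in_itv/= andbT => rZ; nra.
Qed.

Lemma cdf_le r : r <= 0 -> (cdf Z r <= ((1 + C) * (1 + r ^+ 2)^-1)%:E)%E.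
Proof.
move=> r0; apply: second_moment_tail; first exact: measurable_funPTI.
by move=> w /=; rewrite in_itv/= => rZ; nra.
Qed.

End tail_bound.

(** * Convergence of means under a common second moment bound *)

Section convergence_of_means.
Context (R : realType) (ds : nat -> measure_display)
  (Ts : forall n, measurableType (ds n)) (Ps : forall n, probability (Ts n) R)
  (Zs : forall n, {RV (Ps n) >-> R})
  d (T : measurableType d) (P : probability T R) (Z : {RV P >-> R}) (C : R).
Hypothesis cvgZ : cvg_in_distribution Zs Z.
Hypothesis ZC : forall n, (moment (Zs n) 2 <= C%:E)%E.

Let mu := @lebesgue_measure R.

Let C_ge0 : 0 <= 1 + C.
Proof.
rewrite addr_ge0// -lee_fin (le_trans _ (ZC 0))// /moment.
by rewrite expectation_ge0// => w; rewrite sqr_ge0.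
Qed.

Let cvg_ccdf r : {for r, continuous (cdf Z)} ->
  ccdf (Zs n) r @[n --> \oo] --> ccdf Z r.
Proof.
move=> cr; under eq_fun do rewrite ccdf_1_cdf.
rewrite ccdf_1_cdf; apply: cvgeB; [|exact: cvg_cst|exact: cvgZ].
by rewrite fin_num_adde_defr.
Qed.

Let ae_continuous (D : set R) (Q : R -> Prop) :
  (forall r, D r -> {for r, continuous (cdf Z)} -> Q r) ->
  {ae mu, forall r, D r -> Q r}.
Proof.
move=> DQ; apply: negligibleS (cdf_discontinuity_null Z) => r /=.
by apply: contra_not => cr Dr; exact: DQ.
Qed.

(** The mean of [Y^\+] is the integral of [P (Y > r)] over [r >= 0]. These tails converge at almost
    every [r] and have a common integrable majorant; dominated convergence also makes the limit
    integrable. *)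
Lemma cvg_mean_pos : P.-integrable [set: T] (EFin \o Z^\+) /\
  'E_(Ps n)[(Zs n)^\+]%E @[n --> \oo] --> 'E_P[Z^\+]%E.
Proof.
have EE d' (S : measurableType d') (Q : probability S R) (Y : {RV Q >-> R}) :
    'E_Q[Y^\+]%E = (\int[mu]_(r in `[0%R, +oo[) ccdf Y r)%E.
  rewrite ge0_expectation_ccdf; last by move=> ?; exact: funrpos_ge0.
  apply: eq_integral => r /[!inE]/= r0y; congr (Q _).
  apply: eq_set => a/=; move: r0y; rewrite !in_itv/= !andbT => r0.
  by rewrite lt_max (ltNge r 0) r0 orbF.
have [|||||i _ cv] := (@dominated_convergence _ _ _ mu `[0, +oo[ (measurable_itv _)
  (fun n r => ccdf (Zs n) r) (fun r => ccdf Z r)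
  (fun r => ((1 + C) * (1 + r ^+ 2)^-1)%:E)).
- by move=> n; apply: measurable_funTS; exact: ccdf_measurable.
- by apply: measurable_funTS; exact: ccdf_measurable.
- by apply: ae_continuous => r _; exact: cvg_ccdf.
- exact: integrable_inv_oneDsqr_pos.
- apply: aeW => r n; rewrite /= in_itv/= andbT => r0.
  by rewrite gee0_abs//; apply: ccdf_le (ZC n) _ r0.
split; last by rewrite EE; under eq_fun do rewrite EE.
apply/integrableP; split.
  by apply/measurable_EFinP/measurable_funrpos/measurable_funPT.
under eq_integral do rewrite gee0_abs ?lee_fin ?funrpos_ge0//.
have := EE _ _ _ Z; rewrite unlock => ->.
by case/integrableP: i => _; under eq_integral do rewrite gee0_abs//.
Qed.

Lemma cvg_mean_neg : P.-integrable [set: T] (EFin \o Z^\-) /\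
  'E_(Ps n)[(Zs n)^\-]%E @[n --> \oo] --> 'E_P[Z^\-]%E.
Proof.
have EE d' (S : measurableType d') (Q : probability S R) (Y : {RV Q >-> R}) :
    'E_Q[Y^\-]%E = (\int[mu]_(r in `]-oo, 0%R[) cdf Y r)%E.
  (* The mean of a nonpositive variable is minus the integral of its distribution function over the
     negative half-line. *)
  pose N : {RV Q >-> R} := (- Y^\-)%R.
  have NE : 'E_Q[N]%E = (- 'E_Q[Y^\-])%E.
    by rewrite !unlock -integral_ge0N// => w _; rewrite lee_fin funrneg_ge0.
  apply: oppe_inj; rewrite -NE le0_expectation_cdf; last first.
    by move=> w; rewrite oppr_le0 funrneg_ge0.
  congr (- _)%E; apply: eq_integral => r /[!inE]/= rNy0; congr (Q _).
  apply: eq_set => w/=; move: rNy0; rewrite !in_itv/= => r0.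
  by rewrite lerNl le_max lerN2 (leNgt _ 0) oppr_gt0 r0 orbF.
have [|||||i _ cv] := (@dominated_convergence _ _ _ mu `]-oo, 0[ (measurable_itv _)
  (fun n r => cdf (Zs n) r) (fun r => cdf Z r)
  (fun r => ((1 + C) * (1 + r ^+ 2)^-1)%:E)).
- by move=> n; apply: measurable_funTS; exact: cdf_measurable.
- by apply: measurable_funTS; exact: cdf_measurable.
- by apply: ae_continuous => r _; exact: cvgZ.
- exact: integrable_inv_oneDsqr_neg.
- apply: aeW => r n; rewrite /= in_itv/= => r0.
  by rewrite gee0_abs//; apply: cdf_le (ZC n) _ (ltW r0).
split; last by rewrite EE; under eq_fun do rewrite EE.
apply/integrableP; split.
  by apply/measurable_EFinP/measurable_funrneg/measurable_funPT.
under eq_integral do rewrite gee0_abs ?lee_fin ?funrneg_ge0//.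
have := EE _ _ _ Z; rewrite unlock => ->.
by case/integrableP: i => _; under eq_integral do rewrite gee0_abs//.
Qed.

End convergence_of_means.

(** * Signed powers *)

Section signed_power.
Variables (R : realType) (k : nat).
Implicit Types x y r : R.

(* An increasing bijection, so that distribution functions transform by a mere
   change of variable; both parities of the moments are read off its parts. *)
Definition signed_power x : R := x * `|x| ^+ k.

Lemma continuous_signed_power : continuous signed_power.
Proof.
move=> x; apply: cvgM; first exact: cvg_id.
suff : continuous ((fun y : R => y ^+ k) \o (fun y : R => `|y|)) by exact.
move=> y; apply: continuous_comp; first exact: (@norm_continuous _ R^o).
exact: exprn_continuous.
Qed.

Let measurable_signed_power : measurable_fun [set: R] signed_power.
Proof. by apply: continuous_measurable_fun; exact: continuous_signed_power. Qed.

HB.instance Definition _ :=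
  isMeasurableFun.Build _ _ _ _ signed_power measurable_signed_power.

Lemma signed_power_pos x : 0 <= x -> signed_power x = x ^+ k.+1.
Proof. by move=> x0; rewrite /signed_power ger0_norm// exprS. Qed.

Lemma signed_power_neg x : x <= 0 -> signed_power x = - (- x) ^+ k.+1.
Proof. by move=> x0; rewrite /signed_power ler0_norm// exprS mulNr opprK. Qed.

Lemma signed_power_lt : {homo signed_power : x y / x < y}.
Proof.
move=> x y xy; have [x0|x0] := leP 0 x.
  have y0 : 0 <= y by lra.
  by rewrite !signed_power_pos// ltrXn2r//.
have [y0|y0] := leP y 0.
  rewrite !signed_power_neg//; last lra.
  by rewrite ltrN2 ltrXn2r//; lra.
rewrite signed_power_neg ?(ltW x0)// signed_power_pos ?(ltW y0)//.
apply: (@lt_trans _ _ 0); last exact: exprn_gt0.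
by rewrite oppr_lt0 exprn_gt0// oppr_gt0.
Qed.

Lemma signed_power_le : {mono signed_power : x y / x <= y}.
Proof. exact: (le_mono signed_power_lt). Qed.

Lemma signed_power_surj r : exists x, signed_power x = r.
Proof.
have root y : 0 <= y -> exists2 x, 0 <= x & x ^+ k.+1 = y.
  move=> y0; exists (y `^ (k.+1%:R)^-1); first exact: powR_ge0.
  by rewrite -powR_mulrn ?powR_ge0// -powRrM mulVf// powRr1.
have [r0|r0] := leP 0 r.
  by have [x x0 <-] := root r r0; exists x; rewrite signed_power_pos.
have [|x x0 xr] := root (- r); first lra.
exists (- x); rewrite signed_power_neg ?opprK ?xr ?opprK//.
by rewrite oppr_le0.
Qed.

Lemma exprS_signed_power x : x ^+ k.+1 =
  Num.max (signed_power x) 0 + (-1) ^+ k.+1 * Num.max (- signed_power x) 0.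
Proof.
have [x0|x0] := leP 0 x.
  rewrite signed_power_pos// max_l ?exprn_ge0// max_r ?mulr0 ?addr0//.
  by rewrite oppr_le0 exprn_ge0.
rewrite signed_power_neg ?(ltW x0)// opprK max_r ?add0r ?max_l.
- by rewrite -exprMn mulN1r opprK.
- by rewrite exprn_ge0// oppr_ge0 ltW.
- by rewrite oppr_le0 exprn_ge0// oppr_ge0 ltW.
Qed.

Lemma signed_power_sqr x : signed_power x ^+ 2 = x ^+ (2 * k.+1).
Proof.
by rewrite /signed_power exprMn -exprM mulnC exprM real_normK ?num_real// -exprS -exprM.
Qed.

End signed_power.

(** * From means of signed powers to moments *)

Section convergence_of_moments.
Context (R : realType) (ds : nat -> measure_display)
  (Ts : forall n, measurableType (ds n)) (Ps : forall n, probability (Ts n) R)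
  (Xs : forall n, {RV (Ps n) >-> R})
  d (T : measurableType d) (P : probability T R) (X : {RV P >-> R}).
Hypothesis cvgX : cvg_in_distribution Xs X.

Let S (k : nat) : {mfun R >-> R} := @signed_power R k.

Let cdf_signed_power d' (T' : measurableType d') (Q : probability T' R)
    (Y : {RV Q >-> R}) k x :
  cdf (S k \o Y : {RV Q >-> R}) (signed_power k x) = cdf Y x.
Proof.
congr (Q _); apply: eq_set => w /=.
by rewrite !in_itv/= /S/= signed_power_le.
Qed.

(** Every point is some [signed_power k x], where the new distribution function takes the value of
    the old one at [x]; continuity at one point gives continuity at the other. *)
Lemma cvg_signed_power k : cvg_in_distribution
  (fun n => S k \o Xs n : {RV Ps n >-> R}) (S k \o X : {RV P >-> R}).
Proof.
move=> r; have [x <-] := signed_power_surj k r => cr.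
under eq_fun do rewrite cdf_signed_power.
rewrite cdf_signed_power; apply: cvgX.
rewrite (_ : cdf X = cdf (S k \o X : {RV P >-> R}) \o signed_power k).
  by apply: continuous_comp => //; exact: continuous_signed_power.
by apply/funext => y /=; rewrite cdf_signed_power.
Qed.

(** The bound on moments of order [2 (k + 1)] is a second moment bound for the signed powers, so the
    means of their positive and negative parts converge; the moment of order [k + 1] is a
    combination of these with sign [(-1)^(k+1)]. *)
Lemma cvg_moment k (C : R) :
  (forall n, (moment (Xs n) (2 * k.+1) <= C%:E)%E) ->
  P.-integrable [set: T] (EFin \o (fun w => X w ^+ k.+1)) /\
  moment (Xs n) k.+1 @[n --> \oo] --> moment X k.+1.
Proof.
move=> XC.
have ZC n : (moment (S k \o Xs n : {RV Ps n >-> R}) 2 <= C%:E)%E.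
  by apply: le_trans (XC n); rewrite /moment; under eq_fun do rewrite /= signed_power_sqr.
have [ipos cpos] := cvg_mean_pos (@cvg_signed_power k) ZC.
have [ineg cneg] := cvg_mean_neg (@cvg_signed_power k) ZC.
pose e : R := (-1) ^+ k.+1.
have momentE d' (T' : measurableType d') (Q : probability T' R) (Y : {RV Q >-> R}) :
    Q.-integrable [set: T'] (EFin \o (S k \o Y)^\+) ->
    Q.-integrable [set: T'] (EFin \o (S k \o Y)^\-) ->
  Q.-integrable [set: T'] (EFin \o (fun w => Y w ^+ k.+1)) /\
  (moment Y k.+1 = 'E_Q[(S k \o Y)^\+] + e%:E * 'E_Q[(S k \o Y)^\-])%E.
  move=> ip im.
  have YE : (EFin \o (fun w => Y w ^+ k.+1)) = ((EFin \o ((S k \o Y)^\+)%R) \+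
      (fun w => e%:E * (EFin \o ((S k \o Y)^\-)%R) w))%E.
    by apply/funext => w /=; rewrite exprS_signed_power -EFinM -EFinD.
  have ie := integrableZl measurableT e im.
  split; first by rewrite YE; exact: integrableD.
  rewrite /moment unlock.
  rewrite [LHS](_ : _ = \int[Q]_w ((EFin \o (fun w => Y w ^+ k.+1)%R) w))%E//.
  by rewrite YE integralD// integralZl.
(* A constant sequence, to get integrability for each [Xs n]. *)
have cstZ n : cvg_in_distribution
    (fun _ : nat => S k \o Xs n : {RV Ps n >-> R}) (S k \o Xs n : {RV Ps n >-> R}).
  by move=> x _; exact: cvg_cst.
have iposn n := (cvg_mean_pos (cstZ n) (fun=> ZC n)).1.
have inegn n := (cvg_mean_neg (cstZ n) (fun=> ZC n)).1.
have [iX ->] := momentE _ _ _ X ipos ineg; split => //.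
under eq_fun do rewrite (momentE _ _ _ _ (iposn _) (inegn _)).2.
apply: cvgeD => //; last exact: cvgeZl.
by rewrite fin_num_adde_defr// unlock integrable_fin_num.
Qed.

End convergence_of_moments.

(** * Determinacy from exponential moments *)

Section exponential_integrability.
Context d (T : measurableType d) (R : realType) (P : probability T R).
Variable X : {RV P >-> R}.
Hypothesis momX : forall a : R, 0 < a -> exists C : R, forall n, ~~ odd n ->
  (moment X n <= (C * n`!%:R / a ^+ n)%:E)%E.

Let mX : measurable_fun [set: T] X.
Proof. exact: measurable_funPT. Qed.

(** Terms of the series of [exp (b X) + exp (- b X)]. The odd ones cancel, so even moments suffice
    and the partial sums increase. *)
Let term (b : R) i w : R := (b * X w) ^+ i / i`!%:R + (- (b * X w)) ^+ i / i`!%:R.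

Let termE b i w : term b i w = if odd i then 0 else 2 * b ^+ i / i`!%:R * X w ^+ i.
Proof.
rewrite /term exprNn -signr_odd; case: (odd i); first by rewrite expr1 mulN1r mulNr subrr.
by rewrite expr0 mul1r exprMn; ring.
Qed.

Let term_ge0 b i w : 0 <= b -> 0 <= term b i w.
Proof.
move=> b0; rewrite termE; case: ifPn => // ei.
by rewrite mulr_ge0 ?exprn_even_ge0// mulr_ge0 ?mulr_ge0 ?exprn_ge0.
Qed.

Let cvg_term b w : \sum_(0 <= i < n) term b i w @[n --> \oo] -->
  expR (b * X w) + expR (- (b * X w)).
Proof.
under eq_fun do rewrite big_split/=.
by apply: cvgD; exact: is_cvg_series_exp_coeff.
Qed.

Let m_term b i : measurable_fun [set: T] (fun w => (term b i w)%:E).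
Proof.
apply/measurable_EFinP; apply: measurable_funD; apply: measurable_funM => //.
  by apply: measurable_funX; exact: measurable_funM.
by apply: measurable_funX; apply: measurableT_comp => //; exact: measurable_funM.
Qed.

(** Moment growth at rate [a = 2 b] leaves a geometric bound of ratio [1/2]. *)
Let mean_term b C i : 0 < b ->
  (forall n, ~~ odd n -> (moment X n <= (C * n`!%:R / (2 * b) ^+ n)%:E)%E) ->
  (\int[P]_w (term b i w)%:E <= (geometric (2 * C) 2^-1 i)%:E)%E.
Proof.
move=> b0 XC; have C0 : 0 <= C.
  have := XC 0 isT; rewrite expr0 divr1 mulr1 -lee_fin; apply: le_trans.
  by apply: expectation_ge0 => w; rewrite expr0.
under eq_integral do rewrite termE.
case: (boolP (odd i)) => ei.
  by rewrite integral0 lee_fin /= mulr_ge0 ?mulr_ge0 ?exprn_ge0.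
under eq_integral do rewrite EFinM.
rewrite ge0_integralZl//.
- have -> : geometric (2 * C) 2^-1 i =
      (2 * b ^+ i / i`!%:R) * (C * i`!%:R / (2 * b) ^+ i).
    rewrite /= exprVn exprMn; field.
    by rewrite !expf_neq0 ?gt_eqF// ltr0n fact_gt0.
  rewrite [in leRHS]EFinM lee_wpmul2l//.
    by rewrite lee_fin mulr_ge0 ?mulr_ge0 ?exprn_ge0 ?ltW.
  by have := XC i ei; rewrite /moment unlock.
- by apply/measurable_EFinP; exact: measurable_funX.
- by move=> w _; rewrite lee_fin exprn_even_ge0.
- by rewrite lee_fin mulr_ge0 ?mulr_ge0 ?exprn_ge0 ?ltW.
Qed.

(** Monotone convergence of the partial sums, whose means stay below the geometric sum [4 C]. *)
Lemma mean_cosh_lty (b : R) : 0 < b ->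
  (\int[P]_w (expR (b * X w) + expR (- (b * X w)))%:E < +oo)%E.
Proof.
move=> b0; have [C XC] : exists C : R, forall n, ~~ odd n ->
  (moment X n <= (C * n`!%:R / (2 * b) ^+ n)%:E)%E by apply: momX; rewrite mulr_gt0.
have C0 : 0 <= C.
  have := XC 0 isT; rewrite expr0 divr1 mulr1 -lee_fin; apply: le_trans.
  by apply: expectation_ge0 => w; rewrite expr0.
pose S n w := (\sum_(0 <= i < n) term b i w)%:E.
have SE n w : S n w = (\sum_(0 <= i < n) (term b i w)%:E)%E by rewrite sumEFin.
have limS w : limn (S ^~ w) = (expR (b * X w) + expR (- (b * X w)))%:E.
  by apply/cvg_lim => //; apply: cvg_EFin; [exact: nearW|exact: cvg_term].
under eq_integral do rewrite -limS.
have mS n : measurable_fun [set: T] (S n).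
  rewrite (funext (SE n)); exact: emeasurable_sum.
have S_ge0 n w : [set: T] w -> (0 <= S n w)%E.
  by move=> _; rewrite lee_fin sumr_ge0// => i _; rewrite term_ge0// ltW.
have S_nd w : [set: T] w -> {homo S ^~ w : n m / (n <= m)%N >-> (n <= m)%E}.
  move=> _ n m nm; rewrite lee_fin (big_cat_nat (leq0n _) nm)//= lerDl.
  by rewrite sumr_ge0// => i _; rewrite term_ge0// ltW.
have cvgS := @cvg_monotone_convergence _ _ _ P _ measurableT S mS S_ge0 S_nd.
apply: (@le_lt_trans _ _ (4 * C)%:E); last exact: ltry.
rewrite -(cvg_lim _ cvgS)//.
apply: lime_le; first by apply/cvg_ex; eexists; exact: cvgS.
apply: nearW => n; under eq_integral do rewrite SE.
  rewrite ge0_integral_sum//; last by move=> i w _; rewrite lee_fin term_ge0// ltW.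
  apply: le_trans (_ : (\sum_(0 <= i < n) (geometric (2 * C) 2^-1 i)%:E <= _)%E).
    by apply: lee_sum => i _; exact: mean_term.
  rewrite sumEFin lee_fin; apply: le_trans (geometric_le_lim n _ _ _) _ => //.
  + by rewrite mulr_ge0.
  + by rewrite ger0_norm// invf_lt1// ltr1n.
  by rewrite le_eqVlt; apply/orP; left; apply/eqP; field.
Qed.

Lemma integrable_expR_norm (b : R) : 0 < b ->
  P.-integrable [set: T] (fun w => (expR (b * `|X w|))%:E).
Proof.
move=> b0; have mE : measurable_fun [set: T] (fun w => expR (b * `|X w|)).
  apply: measurableT_comp => //; apply: measurable_funM => //.
  exact: measurableT_comp.
apply/integrableP; split; first exact/measurable_EFinP.
apply: le_lt_trans (mean_cosh_lty b0); apply: ge0_le_integral => //.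
- by apply: measurableT_comp => //; exact/measurable_EFinP.
- apply/measurable_EFinP; apply: measurable_funD; apply: measurableT_comp => //.
    exact: measurable_funM.
  by apply: measurableT_comp => //; exact: measurable_funM.
- move=> w _; rewrite lee_fin ger0_norm ?expR_ge0//.
  by case: (ger0P (X w)) => _; rewrite ?mulrN ?lerDl ?lerDr expR_ge0.
Qed.

Lemma exp_bounded_integrable (g : R -> R) (C b : R) :
  measurable_fun [set: R] g -> 0 < b -> (forall x, `|g x| <= C * expR (b * `|x|)) ->
  P.-integrable [set: T] (fun w => (g (X w))%:E).
Proof.
move=> mg b0 gb.
apply: (@le_integrable _ _ _ P _ measurableT _
  (fun w => C%:E * (expR (b * `|X w|))%:E)%E).
- by apply/measurable_EFinP; exact: measurableT_comp.
- move=> w _; rewrite -EFinM lee_fin (le_trans (gb _))// ler_norm//.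
- by apply: integrableZl => //; exact: integrable_expR_norm.
Qed.

Lemma exp_moments_has_moments : has_moments X.
Proof.
move=> k; apply: (@exp_bounded_integrable (fun x => x ^+ k) k`!%:R 1) => //.
move=> x; rewrite mul1r normrX -ler_pdivrMl ?ltr0n ?fact_gt0// mulrC.
case: k => [|k]; first by rewrite expr0 fact0 divr1 -expR0 ler_expR.
by apply: le_trans (expR_ge1Dxn k (normr_ge0 x)); rewrite lerDr.
Qed.

End exponential_integrability.

(** * Exponentially dominated limits of polynomials *)

Section tame_functions.
Variable R : realType.
Implicit Types (g h : R -> R) (x : R).

(* Such functions have means determined by the moments, by dominated
   convergence; allowing arbitrary polynomials, rather than Taylor sums, makes
   closure under products immediate. *)
Definition exp_tame g := exists (p : nat -> {poly R}) (C B : R),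
  [/\ 0 < B, forall n x, `|(p n).[x]| <= C * expR (B * `|x|) &
      forall x, (p n).[x] @[n --> \oo] --> g x].

Lemma exp_tame_cst c : exp_tame (cst c).
Proof.
exists (fun=> c%:P), `|c|, 1; split => // [n x|x].
  rewrite hornerC mul1r ler_peMr// -expR0 ler_expR//.
by under eq_fun do rewrite hornerC; exact: cvg_cst.
Qed.

Lemma exp_tame_add g h : exp_tame g -> exp_tame h -> exp_tame (fun x => g x + h x).
Proof.
move=> [p [C [B [B0 pC pg]]]] [q [D [E [E0 qD qh]]]].
have C0 : 0 <= C.
  by have := le_trans (normr_ge0 _) (pC 0%N 0); rewrite normr0 mulr0 expR0 mulr1.
have D0 : 0 <= D.
  by have := le_trans (normr_ge0 _) (qD 0%N 0); rewrite normr0 mulr0 expR0 mulr1.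
exists (fun n => p n + q n), (C + D), (B + E); split => [|n x|x].
- exact: addr_gt0.
- rewrite hornerD (le_trans (ler_normD _ _))// mulrDl lerD//.
  + rewrite (le_trans (pC n x))// ler_wpM2l// ler_expR ler_wpM2r//; lra.
  + rewrite (le_trans (qD n x))// ler_wpM2l// ler_expR ler_wpM2r//; lra.
- by under eq_fun do rewrite hornerD; exact: cvgD.
Qed.

Lemma exp_tame_mul g h : exp_tame g -> exp_tame h -> exp_tame (fun x => g x * h x).
Proof.
move=> [p [C [B [B0 pC pg]]]] [q [D [E [E0 qD qh]]]].
exists (fun n => p n * q n), (C * D), (B + E); split => [|n x|x].
- exact: addr_gt0.
- by rewrite hornerM normrM mulrDl expRD mulrACA ler_pM.
- by under eq_fun do rewrite hornerM; exact: cvgM.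
Qed.

Lemma exp_tame_exp g n : exp_tame g -> exp_tame (fun x => g x ^+ n).
Proof.
move=> tg; elim: n => [|n IH].
  by under eq_fun do rewrite expr0; exact: exp_tame_cst.
by under eq_fun do rewrite exprS; exact: exp_tame_mul.
Qed.

(** Taylor sums of [sin (t (x - c))] as polynomials in [x]. *)
Let sin_poly (t c : R) n : {poly R} := \sum_(0 <= i < n)
  ((odd i)%:R * (-1) ^+ i.-1./2 / i`!%:R)%:P * (t%:P * ('X - c%:P)) ^+ i.

Let sin_polyE t c n x : (sin_poly t c n).[x] = series (sin_coeff (t * (x - c))) n.
Proof.
rewrite horner_sum; apply: eq_bigr => i _.
by rewrite /sin_coeff/= !(hornerM, horner_exp, hornerD, hornerN, hornerC, hornerX); ring.
Qed.

(** Termwise, the sine series is dominated by the exponential series at [|x|]. *)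
Let sin_coeff_norm x n : `|series (sin_coeff x) n| <= expR `|x|.
Proof.
apply: (@le_trans _ _ (series (exp_coeff `|x|) n)).
  apply: le_trans (ler_norm_sum _ _ _) _; apply: ler_sum => i _.
  rewrite /sin_coeff /exp_coeff /= !normrM normrX normrN normr1 expr1n mulr1.
  rewrite normfV [X in _ / X]ger0_norm// normrX ler_wpM2r//.
  by rewrite ler_piMl ?exprn_ge0//; case: odd; rewrite ?normr1 ?normr0.
apply: nondecreasing_cvgn_le; last exact: is_cvg_series_exp_coeff.
by apply/nondecreasing_series => i _ _; exact: exp_coeff_ge0.
Qed.

Lemma exp_tame_sin (t c : R) : 0 < t -> exp_tame (fun x => sin (t * (x - c))).
Proof.
move=> t0; exists (sin_poly t c), (expR (t * `|c|)), t; split => // [n x|x].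
  rewrite sin_polyE (le_trans (sin_coeff_norm _ _))// -expRD ler_expR.
  rewrite normrM gtr0_norm// -mulrDr ler_wpM2l ?(ltW t0)//.
  by rewrite (le_trans (ler_normB _ _))// addrC.
under eq_fun do rewrite sin_polyE.
by rewrite unlock; exact: is_cvg_series_sin_coeff.
Qed.

Lemma measurable_horner (p : {poly R}) : measurable_fun [set: R] (fun x => p.[x]).
Proof.
under eq_fun do rewrite horner_coef.
by apply: measurable_sum => i; apply: measurable_funM => //; exact: measurable_funX.
Qed.

Lemma exp_tame_measurable g : exp_tame g -> measurable_fun [set: R] g.
Proof.
move=> [p [C [B [_ _ pg]]]].
apply: (@measurable_fun_cvg _ _ _ _ (fun n x => (p n).[x])) => // n.
exact: measurable_horner.
Qed.

End tame_functions.

(** * Functions with equal means under both laws *)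

Section equal_moments.
Context (R : realType) d (T : measurableType d) (P : probability T R)
  (X : {RV P >-> R}) d' (S : measurableType d') (Q : probability S R)
  (Y : {RV Q >-> R}).
Hypothesis intX : forall b : R, 0 < b ->
  P.-integrable [set: T] (fun w => (expR (b * `|X w|))%:E).
Hypothesis intY : forall b : R, 0 < b ->
  Q.-integrable [set: S] (fun w => (expR (b * `|Y w|))%:E).
Hypotheses (momX : has_moments X) (momY : has_moments Y).
Hypothesis momXY : forall k, moment Y k = moment X k.

Definition same_mean (g : R -> R) :=
  (\int[P]_w (g (X w))%:E = \int[Q]_w (g (Y w))%:E)%E.

Lemma mean_horner d0 (U : measurableType d0) (M : probability U R)
    (Z : {RV M >-> R}) (p : {poly R}) : has_moments Z ->
  (\int[M]_w (p.[Z w])%:E = \sum_(i < size p) (p`_i)%:E * moment Z i)%E.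
Proof.
move=> mZ; under eq_integral do rewrite horner_coef -sumEFin.
rewrite integral_sum//; last first.
  by move=> i; under eq_fun do rewrite EFinM; apply: integrableZl => //; exact: mZ.
apply: eq_bigr => i _; under eq_integral do rewrite EFinM.
by rewrite integralZl//; [rewrite /moment unlock|exact: mZ].
Qed.

Lemma same_mean_tame g : exp_tame g -> same_mean g.
Proof.
move=> tg; have mg := exp_tame_measurable tg.
case: tg => [p [C [B [B0 pC pg]]]].
have cvg_mean d0 (U : measurableType d0) (M : probability U R) (Z : {RV M >-> R}) :
    M.-integrable [set: U] (fun w => (expR (B * `|Z w|))%:E) ->
    (\int[M]_w ((p n).[Z w])%:E @[n --> \oo] --> \int[M]_w (g (Z w))%:E)%E.
  move=> iZ; apply: (@dominated_cvg _ _ _ M _ measurableT _ _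
    (fun w => C%:E * (expR (B * `|Z w|))%:E)%E) => //.
  - move=> n; apply/measurable_EFinP; apply: (measurableT_comp (measurable_horner (p n))).
    exact: measurable_funPT.
  - by move=> w _; apply: cvg_EFin; [exact: nearW|exact: pg].
  - by apply: integrableZl => //; exact: iZ.
  - by move=> n w _; rewrite -EFinM lee_fin.
have := cvg_mean _ _ _ _ (intY B0).
(* Both laws give [p n] the same mean, a linear combination of common moments. *)
under eq_fun do (rewrite mean_horner//; under eq_bigr do rewrite momXY).
under eq_fun do rewrite -mean_horner//.
by move=> h; exact: cvg_unique (cvg_mean _ _ _ _ (intX B0)) h.
Qed.

(** Bounded convergence, to reach indicators from tame functions. *)
Lemma same_mean_lim (g_ : nat -> R -> R) (g : R -> R) :
  (forall n, measurable_fun [set: R] (g_ n)) ->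
  (forall n x, `|g_ n x| <= 1) -> (forall x, g_ n x @[n --> \oo] --> g x) ->
  (forall n, same_mean (g_ n)) -> same_mean g.
Proof.
move=> mg g1 gg gXY.
have cvg_mean d0 (U : measurableType d0) (M : probability U R) (Z : {RV M >-> R}) :
    (\int[M]_w (g_ n (Z w))%:E @[n --> \oo] --> \int[M]_w (g (Z w))%:E)%E.
  apply: (@dominated_cvg _ _ _ M _ measurableT _ _ (cst 1%E)) => //.
  - by move=> n; apply/measurable_EFinP; exact: measurableT_comp.
  - by move=> w _; apply: cvg_EFin; [exact: nearW|exact: gg].
  - exact: finite_measure_integrable_cst.
  - by move=> n w _; rewrite lee_fin.
have := cvg_mean _ _ _ Y; under eq_fun do rewrite -gXY.
by move=> h; exact: cvg_unique (cvg_mean _ _ _ X) h.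
Qed.

End equal_moments.

(** * Approximation of indicators of rays *)

Section indicator_approximation.
Variable R : realType.
Implicit Types (u w q x c : R).

Lemma bernoulli_ineq u n : -1 <= u -> 1 + n%:R * u <= (1 + u) ^+ n.
Proof.
move=> u1; elim: n => [|n IH]; first by rewrite mul0r addr0 expr0.
rewrite exprS; apply: le_trans (ler_wpM2l _ IH); last lra.
by rewrite -natr1; have := ler0n R n; nra.
Qed.

(** With [s] the square root of [q], Bernoulli's inequality for [1 / s] bounds [n s^n] by
    [1 / (1 / s - 1)], and the remaining factor [s^n] tends to zero. *)
Lemma cvg_natM_expr q : 0 <= q -> q < 1 -> n%:R * q ^+ n @[n --> \oo] --> 0.
Proof.
move=> q0 q1; have [->|qn0] := eqVneq q 0.
  apply: cvg_near_cst; exists 1%N => // n /= n0.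
  by rewrite expr0n (gtn_eqF n0) mulr0.
have {qn0}q0 : 0 < q by rewrite lt_def qn0.
pose s := Num.sqrt q; have s0 : 0 < s by rewrite sqrtr_gt0.
have s1 : s < 1 by rewrite -sqrtr1 ltr_sqrt.
have qE : q = s ^+ 2 by rewrite sqr_sqrtr// ltW.
have sV : 0 < s^-1 - 1 by rewrite subr_gt0 invf_gt1.
apply: (@squeeze_cvgr _ _ _ _ (cst 0) (fun n => geometric (s^-1 - 1)^-1 s n)).
- apply: nearW => n /=; rewrite mulr_ge0 ?exprn_ge0 ?(ltW q0)//=.
  rewrite qE -exprM mulnC exprM expr2 mulrA ler_wpM2r ?exprn_ge0 ?(ltW s0)//.
  rewrite -ler_pdivlMr ?exprn_gt0//.
  rewrite ler_pdivlMl// -exprVn.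
  have := @bernoulli_ineq (s^-1 - 1) n; rewrite addrCA subrr addr0 => h.
  by have := h ltac:(lra); lra.
- exact: cvg_cst.
- by apply: cvg_geometric; rewrite gtr0_norm.
Qed.

(* As [n] grows, [n * 2 ^ n * w ^ n] tends to [0] if [w < 1/2] and to infinity
   otherwise; the factor [n] settles the boundary case [w = 1/2]. *)
Definition soft_indicator n w : R := (1 - w ^+ n) ^+ (n * 2 ^ n).

Lemma soft_indicator_bounded n w : 0 <= w <= 1 -> 0 <= soft_indicator n w <= 1.
Proof.
move=> /andP[w0 w1]; have wn0 : 0 <= w ^+ n by rewrite exprn_ge0.
have wn1 : w ^+ n <= 1 by rewrite exprn_ile1.
by rewrite /soft_indicator exprn_ge0 ?exprn_ile1//; lra.
Qed.

(** Below [1/2], Bernoulli's inequality gives the lower bound [1 - n (2 w)^n]. From [1/2] on,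
    multiplying by [(1 + w^n)^(n 2^n)], which is at least [1 + n (2 w)^n >= n + 1], still gives at
    most [1], whence the upper bound [1 / (n + 1)]. *)
Lemma cvg_soft_indicator w : 0 <= w <= 1 ->
  soft_indicator n w @[n --> \oo] --> ((w < 2^-1)%R%:R : R).
Proof.
move=> w01; have [w2|w2] := ltP w 2^-1.
  apply: (@squeeze_cvgr _ _ _ _ (fun n => 1 - n%:R * (2 * w) ^+ n) (cst 1)).
  - apply: nearW => n /=; have /andP[_ ->] := soft_indicator_bounded n w01.
    rewrite andbT /soft_indicator.
    have := @bernoulli_ineq (- w ^+ n) (n * 2 ^ n).
    rewrite natrM natrX mulrN -mulrA -exprMn; apply.
    by rewrite lerN2 exprn_ile1; case/andP: w01.
  - rewrite -[X in _ --> X]subr0; apply: cvgB; first exact: cvg_cst.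
    by apply: cvg_natM_expr; lra.
  - exact: cvg_cst.
apply: (@squeeze_cvgr _ _ _ _ (cst 0) (fun n => n.+1%:R^-1)).
- apply: nearW => n /=; have /andP[-> _] := soft_indicator_bounded n w01.
  rewrite /= -[leRHS]mul1r ler_pdivlMr ?ltr0n//.
  have wn1 : w ^+ n <= 1 by rewrite exprn_ile1; case/andP: w01.
  have wn0 : 0 <= w ^+ n by rewrite exprn_ge0; case/andP: w01.
  apply: (@le_trans _ _ (soft_indicator n w * (1 + w ^+ n) ^+ (n * 2 ^ n))).
    apply: ler_wpM2l; first by have /andP[] := soft_indicator_bounded n w01.
    apply: le_trans (bernoulli_ineq _ _); last by lra.
    rewrite -natr1 addrC lerD2l natrM -mulrA ler_peMr// natrX -exprMn exprn_ege1//.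
    lra.
  rewrite /soft_indicator -exprMn exprn_ile1//; nra.
- exact: cvg_cst.
- exact: cvg_harmonic.
Unshelve. all: by end_near. Qed.

(** Eventually the argument lies strictly between [- pi] and [pi], where the sine has the sign of
    its argument; the sequence is then constant. *)
Lemma cvg_sin_lt0 c x :
  ((sin (m.+1%:R^-1 * (x - c)) < 0)%R%:R : R) @[m --> \oo] --> ((x < c)%R%:R : R).
Proof.
have small : \forall m \near \oo, `|m.+1%:R^-1 * (x - c)| < pi.
  have : m.+1%:R^-1 * (x - c) @[m --> \oo] --> 0.
    by rewrite -[X in _ --> X](mul0r (x - c)); apply: cvgMr_tmp; exact: cvg_harmonic.
  by move=> /cvgr0Pnorm_lt/(_ _ (pi_gt0 R)).
apply: cvg_near_cst; apply: filterS small => m; rewrite ltr_norml => /andP[].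
have m0 : 0 < m.+1%:R^-1 :> R by rewrite invr_gt0.
set u : R := _^-1; have [xc|xc|->] := ltgtP x c.
- have ucx : 0 < u * (c - x) by rewrite mulr_gt0// subr_gt0.
  move=> h _; have : 0 < sin (- (u * (x - c))).
    by apply: sin_gt0_pi; apply/andP; split; lra.
  by rewrite sinN oppr_gt0 => ->.
- have uxc : 0 < u * (x - c) by rewrite mulr_gt0// subr_gt0.
  move=> _ h; have : 0 < sin (u * (x - c)).
    by apply: sin_gt0_pi; rewrite uxc.
  by move=> s0; rewrite ltNge (ltW s0).
- by move=> _ _; rewrite subrr mulr0 sin0 ltxx.
Qed.

End indicator_approximation.

(** * Equality of laws from equality of moments *)

Section determinacy.
Context (R : realType) d (T : measurableType d) (P : probability T R)
  (X : {RV P >-> R}).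
Hypothesis momX : forall a : R, 0 < a -> exists C : R, forall n, ~~ odd n ->
  (moment X n <= (C * n`!%:R / a ^+ n)%:E)%E.

Lemma exp_moments_determined : determined_by_moments X.
Proof.
split; first exact: exp_moments_has_moments.
move=> d' S Q Y momY momXY.
(* The growth bound concerns moments alone, so [Y] inherits it. *)
have momY' (a : R) : 0 < a -> exists C : R, forall n, ~~ odd n ->
    (moment Y n <= (C * n`!%:R / a ^+ n)%:E)%E.
  by move=> /momX[C XC]; exists C => n en; rewrite momXY XC.
have tameXY := same_mean_tame (integrable_expR_norm momX) (integrable_expR_norm momY')
  (exp_moments_has_moments momX) momY momXY.
(* A tame function with values in [[0, 1]], below [1/2] exactly where the sine is negative. *)
pose w (t c x : R) := 2^-1 + 2^-1 * sin (t * (x - c)).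
have w01 t c x : 0 <= w t c x <= 1.
  have := sin_geN1 (t * (x - c)); have := sin_le1 (t * (x - c)).
  by rewrite /w => ? ?; apply/andP; split; lra.
have tw t c : 0 < t -> exp_tame (w t c).
  move=> t0; apply: exp_tame_add; first exact: exp_tame_cst.
  by apply: exp_tame_mul; [exact: exp_tame_cst|exact: exp_tame_sin].
have tsoft t c n : 0 < t -> exp_tame (fun x => soft_indicator n (w t c x)).
  move=> t0; apply: exp_tame_exp; apply: exp_tame_add; first exact: exp_tame_cst.
  rewrite (_ : (fun _ => _) = (fun x => -1 * w t c x ^+ n)); last first.
    by apply/funext => x; rewrite mulN1r.
  by apply: exp_tame_mul; [exact: exp_tame_cst|apply: exp_tame_exp; exact: tw].
have cvg_soft t c x : soft_indicator n (w t c x) @[n --> \oo] -->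
    ((sin (t * (x - c)) < 0)%R%:R : R).
  rewrite (_ : (sin _ < 0) = (w t c x < 2^-1)); first exact: cvg_soft_indicator.
  by rewrite /w; apply/idP/idP; lra.
(* First limit, in [n] at fixed [t]; [ray_mean] is the second one, along [t = 1 / (m + 1)]. *)
have sin_mean (t c : R) : 0 < t ->
    same_mean X Y (fun x => (sin (t * (x - c)) < 0)%R%:R).
  move=> t0; apply: (same_mean_lim _ _ (cvg_soft t c)).
  - by move=> n; apply: exp_tame_measurable; exact: tsoft.
  - move=> n x; have /andP[s0 s1] := soft_indicator_bounded n (w01 t c x).
    by rewrite ger0_norm.
  - by move=> n; apply: tameXY; exact: tsoft.
have msin (t c : R) : 0 < t ->
    measurable_fun [set: R] (fun x => (sin (t * (x - c)) < 0)%R%:R : R).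
  move=> t0; apply: (measurable_fun_cvg _ (fun x _ => cvg_soft t c x)) => n.
  by apply: exp_tame_measurable; exact: tsoft.
have ray_mean c : same_mean X Y (fun x => (x < c)%R%:R).
  apply: (@same_mean_lim _ _ _ _ X _ _ _ Y
    (fun m x => (sin (m.+1%:R^-1 * (x - c)) < 0)%R%:R)) => [|||n].
  3: exact: cvg_sin_lt0.
  - by move=> n; exact: msin.
  - by move=> n x; case: (_ < _); rewrite ?normr1 ?normr0.
  - exact: sin_mean.
have rayE d0 (U : measurableType d0) (M : probability U R) (Z : {RV M >-> R}) c :
    distribution M Z `]-oo, c[ = (\int[M]_u ((Z u < c)%R%:R)%:E)%E.
  rewrite -[LHS]/(M _).
  transitivity (\int[M]_u (\1_(Z @^-1` `]-oo, c[) u)%:E)%E.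
    by rewrite integral_indic ?setIT//; exact: measurable_funPTI.
  by apply: eq_integral => u _; rewrite indicE; congr (_%:R%:E); rewrite mem_setE.
(* Open left rays generate the Borel sets, are stable under intersection and exhaust the line. *)
apply: (@measure_unique _ R _ (@RGenInftyO.G R) (fun n => `]-oo, n%:R[%classic)).
- exact: RGenInftyO.measurableE.
- move=> _ _ [a ->] [b ->]; exists (Num.min a b).
  apply/seteqP; split => x; rewrite /= !in_itv/= lt_min; first by move=> [-> ->].
  by move/andP.
- by move=> n; exists n%:R.
- apply/seteqP; split => // x _.
  exists (Num.truncn `|x|).+1 => //=.
  by rewrite in_itv/= (le_lt_trans (ler_norm x))// Num.Theory.truncnS_gt.
- by move=> _ [c ->]; rewrite /= !rayE ray_mean.
- by move=> n; rewrite (le_lt_trans (probability_le1 _ _)) ?ltry.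
Qed.

End determinacy.

(** * Passage of the uniform moment bounds to the limit law *)

Theorem theorem5p2 (R : realType)
    (ds : nat -> measure_display)
    (Ts : forall n : nat, measurableType (ds n))
    (Ps : forall n : nat, probability (Ts n) R)
    (Xs : forall n : nat, {RV (Ps n) >-> R})
    (f : nat -> {poly int})
    (d : measure_display) (T : measurableType d) (P : probability T R)
    (X : {RV P >-> R}) :
  (forall n : nat, is_cgf R (f n)) ->
  (forall n : nat, has_cgf_law (Xs n) (f n)) ->
  (forall n : nat, (0 < 'V_(Ps n)[Xs n])%E) ->
  cvg_in_distribution (fun n => standardized (Xs n)) X ->
  determined_by_moments X /\
  (forall k : nat, (1 <= k)%N ->
    moment (standardized (Xs n)) k @[n --> \oo] --> moment X k).
Proof.
move=> cgf law V0 cvgX.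
pose C (a : R) := 2 * expR (a ^+ 2 / 2 * expR (2 * a)).
have momW m a n : 0 < a -> ~~ odd n ->
    (moment (standardized (Xs m)) n <= (C a * n`!%:R / a ^+ n)%:E)%E.
  exact: standardized_even_moment_le (cgf m) (law m) (V0 m) a n.
have cvgm k : moment (standardized (Xs n)) k.+1 @[n --> \oo] --> moment X k.+1.
  (* The even moments of order [2 (k + 1)] are bounded uniformly in [n] by [momW] at [a = 1]. *)
  have [|//] := @cvg_moment _ _ _ _ _ _ _ _ _ cvgX k
    (C 1 * (2 * k.+1)`!%:R / 1 ^+ (2 * k.+1)) => n.
  by apply: momW; rewrite // oddM.
split; last by case=> // k _; exact: cvgm.
apply: exp_moments_determined => a a0; exists (C a) => -[_|n en].
  (* [cvgm] covers positive orders only; at order zero every moment is [1], so the bound for the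
     first variable serves for [X]. *)
  apply: le_trans (momW 0%N a 0%N a0 isT).
  have moment0 d1 (U : measurableType d1) (M : probability U R) (Z : {RV M >-> R}) :
      moment Z 0 = 1%E.
    by rewrite /moment; under eq_fun do rewrite expr0; exact: expectation_cst.
  by rewrite !moment0.
rewrite -(cvg_lim _ (cvgm n))//; apply: lime_le.
  by apply/cvg_ex; eexists; exact: cvgm.
by apply: nearW => m; exact: momW.
Qed.
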